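(* The densities $D_{\text{log-indep}}$ and $D_{\text{nat}}$ coincide on the algebra of subsets of $\mathbb{N}$ generated by the inverse images of the functions $\{\beta_{p_j}\}_{j=1}^\infty$ and the sets $\{S_k\}_{k=2}^\infty$.
   Context: $\{p_j\}_{j=1}^\infty$ denotes the primes in increasing order. For a prime $p$ and $n\in\mathbb{N}$, $\beta_p(n)$ is the $p$-adic order of $n$: the nonnegative integer $m$ with $p^m\mid n$ and $p^{m+1}\nmid n$. For $k\ge2$, $S_k$ denotes the set of $k$-free positive integers, i.e. those $n$ with $p^k\nmid n$ for all primes $p$. For $A\subset\mathbb{N}$, the natural density is $D_{\text{nat}}(A)=\lim_{N\to\infty}\frac{|A\cap[N]|}{N}$, $[N]=\{1,\ldots,N\}$, whenever the limit exists. Let $\Omega_N=\{n\in\mathbb{N}: p_j\nmid n \text{ for all } j>N\}$, $C_N=\sum_{n\in\Omega_N}\frac1n<\infty$, and let $P_N$ be the probability measure on $\Omega_N$ given by $P_N(\{n\})=\frac1{C_N}\frac1n$. Then $D_{\text{log-indep}}(A)=\lim_{N\to\infty}P_N(A\cap\Omega_N)=\lim_{N\to\infty}\frac1{C_N}\sum_{n\in A\cap\Omega_N}\frac1n$, whenever the limit exists. An algebra of sets is closed under complements and finite unions. The densities coincide on a collection of sets if for every set in the collection both densities exist and are equal. *)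

(* Defs.v *)
From HB Require Import structures.
From mathcomp Require Import all_boot all_order all_algebra finmap.
From mathcomp Require Import all_classical all_reals all_analysis.

Set Implicit Arguments.
Unset Strict Implicit.
Unset Printing Implicit Defensive.

Import Order.TTheory GRing.Theory Num.Theory.
Import numFieldNormedType.Exports.

Local Open Scope classical_set_scope.
Local Open Scope ring_scope.

(* The natural numbers of the theory start at 1; they are the ambient set for
   complements.  All sets below are subsets of [posn]. *)
Definition posn : set nat := [set n | (0 < n)%N].

Lemma ex_prime_gt (m : nat) : exists p, (m < p)%N && prime p.
Proof. by have [p mp pp] := prime_above m; exists p; rewrite mp. Qed.

Definition next_prime (m : nat) : nat := ex_minn (ex_prime_gt m).

(* Indexed from 1: [nth_prime 1 = 2], [nth_prime 2 = 3], etc.; the index 0 has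
   the meaningless value 0 and is excluded wherever [nth_prime] is used. *)
Definition nth_prime (j : nat) : nat := iter j next_prime 0%N.

(* The p-adic order beta_p(n) is [logn p n]. *)
Definition beta_preimage (j : nat) (B : set nat) : set nat :=
  [set n | posn n /\ B (logn (nth_prime j) n)].

Definition kfree (k : nat) : set nat :=
  [set n | posn n /\ forall p, prime p -> ~~ (p ^ k %| n)%N].

(* Algebras of subsets of D, the finitary analogue of [sigma_algebra D]. *)
Definition set_algebra (T : Type) (D : set T) (F : set (set T)) : Prop :=
  [/\ F set0, (forall A, F A -> F (D `\` A)) & setU_closed F].

(* B ranges over arbitrary sets of values of the p-adic order. *)
Definition generators : set (set nat) :=
  [set A | (exists j B, (0 < j)%N /\ A = beta_preimage j B) \/
           (exists k, (2 <= k)%N /\ A = kfree k)].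

Definition generated_algebra : set (set nat) :=
  smallest (set_algebra posn) generators.

Section densities.
Variable R : realType.

Definition nat_freq (A : set nat) (N : nat) : R :=
  #|` fset_set (A `&` [set n | (1 <= n <= N)%N])|%:R / N%:R.

Definition Omega (N : nat) : set nat :=
  [set n | posn n /\ forall j, (N < j)%N -> ~~ (nth_prime j %| n)%N].

Definition harmonic_mass (A : set nat) : \bar R :=
  (\esum_(n in A) ((n%:R : R)^-1)%:E)%E.

(* The projection [fine] loses nothing: C_N is finite, being the product of
   the geometric series of 1/p over the first N primes p. *)
Definition C_ (N : nat) : R := fine (harmonic_mass (Omega N)).

Definition P_ (N : nat) (A : set nat) : R :=
  (C_ N)^-1 * fine (harmonic_mass (A `&` Omega N)).

Definition has_nat_density (A : set nat) : Prop := cvgn (nat_freq A).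
Definition nat_density (A : set nat) : R := limn (nat_freq A).

Definition has_logindep_density (A : set nat) : Prop :=
  cvgn (fun N => P_ N A).
Definition logindep_density (A : set nat) : R := limn (fun N => P_ N A).

Definition densities_coincide_on (F : set (set nat)) : Prop :=
  forall A, F A -> [/\ has_logindep_density A, has_nat_density A &
                       logindep_density A = nat_density A].

End densities.

(* Main.v *)
Require Import Defs.
From mathcomp Require Import all_boot all_order all_algebra finmap ring lra zify.
From mathcomp Require Import all_classical all_reals all_analysis.
Import Order.TTheory GRing.Theory Num.Theory.
Import numFieldNormedType.Exports.

(** Both densities arise from a sequence of finitely additive weights on sets
of positive integers under which, for every d > 0, the multiples of d have
weight at most 1/d, tending to 1/d.  For the counting measure of [1, N] this is
the size floor(N/d) of the set of multiples; for P_N it is the scaling identity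
sum_{n in Omega_N} 1/(dn) = (1/d) C_N, valid as soon as d lies in Omega_N, since
Omega_N is closed under products and divisors.  Such a sequence is a
[divisibility_mean], and the theorem is that all of them have the same limit on
every set of the algebra.

Call a set elementary if its weight under any finitely additive function is one
fixed linear combination of the weights of the sets of multiples.  Elementary
sets form an algebra because an intersection of two sets of multiples is again
one (of the lcm), and their weights converge to a limit that does not depend on
the mean.  So it is enough to approximate every set of the algebra by elementary
sets, up to an exceptional set whose weight is small uniformly in N and in the
mean ([approximable]).  Approximability passes to complements and unions, which
leaves the generators.

For beta_p, cut the set B of values at L: this matters only for multiples of
p^L, of weight at most p^(-L) ([approximable_logn]).  For k-free integers, keep
only the conditions at primes p <= M: this matters only for integers divisible
by d^2 for some d > M, of weight at most sum_{d > M} 1/d^2 <= 1/M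
([approximable_kfree]).  The last bound is a union over infinitely many d, and
finite additivity alone does not give it; hence the requirement that the weights
be determined by the truncations of a set to initial segments. *)

Set Implicit Arguments.
Unset Strict Implicit.
Unset Printing Implicit Defensive.
Local Open Scope classical_set_scope.
Local Open Scope ring_scope.

(** * Weighted sums over sets of integers *)

Section weighted_sums.
Variable R : realType.
Implicit Types (A B D : set nat) (a : nat -> \bar R).

Lemma subset_esum A B a :
  A `<=` B -> (\esum_(n in A) a n <= \esum_(n in B) a n)%E.
Proof.
move=> AB; apply: ge_ereal_sup => _ [F [finF FA] <-].
by apply: ereal_sup_ubound; exists F => //; split=> // x /FA /AB.
Qed.

Lemma esum_le_truncations A a (M : \bar R) :
  (forall X, (\esum_(n in A `&` `I_X) a n <= M)%E) ->
  (\esum_(n in A) a n <= M)%E.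
Proof.
move=> bnd; apply: ge_ereal_sup => _ [F [finF FA] <-].
have [X FX] : exists X, F `<=` `I_X.
  have /finite_seqP[s ->] := finF.
  exists (\max_(i <- s) i).+1 => n /= ns.
  exact: (@leq_bigmax_seq nat s xpredT id).
apply: le_trans (bnd X); apply: ereal_sup_ubound; exists F => //.
by split=> // x Fx; split; [exact: FA|exact: FX].
Qed.

Lemma esumZl A a (c : R) : 0 <= c -> (forall n, 0 <= a n)%E ->
  (\esum_(n in A) (c%:E * a n) = c%:E * \esum_(n in A) a n)%E.
Proof.
move=> c0 a0; have -> : A = [set n | n \in A] by rewrite set_mem_set.
rewrite -!nneseries_esum ?nneseriesZl// => n _.
by rewrite mule_ge0.
Qed.

(** Masses are taken in the reals, by [fine], so that linear combinations of them
make sense; for summable weights nothing is lost ([weight_massK]). *)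
Definition weight_mass (w : nat -> R) D A : R :=
  fine (\esum_(n in A `&` D) (w n)%:E).

Section mass.
Variables (w : nat -> R) (D : set nat).
Hypotheses (w0 : forall n, 0 <= w n).
Hypotheses (wD : (\esum_(n in D) (w n)%:E < +oo)%E).

Let w0E n : (0 <= (w n)%:E)%E. Proof. by rewrite lee_fin. Qed.

Lemma weight_massK A :
  ((weight_mass w D A)%:E = \esum_(n in A `&` D) (w n)%:E)%E.
Proof.
rewrite /weight_mass fineK// ge0_fin_numE ?esum_ge0//.
by apply: le_lt_trans wD; apply: subset_esum; exact: subIsetr.
Qed.

Lemma weight_mass_ge0 A : 0 <= weight_mass w D A.
Proof. by rewrite -lee_fin weight_massK esum_ge0. Qed.

Lemma weight_massU A B : A `&` B = set0 ->
  weight_mass w D (A `|` B) = weight_mass w D A + weight_mass w D B.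
Proof.
move=> AB0; apply: EFin_inj; rewrite EFinD !weight_massK (esumID A)//.
congr (_ + _)%E; congr (esum _ _); apply/seteqP; split=> n /=.
- by case=> [[]].
- by case=> An Dn; split=> //; split=> //; left.
- by case=> [[[]]].
- case=> [Bn Dn]; split; first by split => //; right.
by move=> An; rewrite -[False]/(set0 n) -AB0.
Qed.

Lemma weight_mass_le_truncations A (M : R) :
  (forall X, weight_mass w D (A `&` `I_X) <= M) -> weight_mass w D A <= M.
Proof.
move=> bnd; rewrite -lee_fin weight_massK; apply: esum_le_truncations => X.
by rewrite setIAC -weight_massK lee_fin.
Qed.

End mass.

End weighted_sums.

(** * Sequences of means under which divisibility by d has weight 1/d *)

Definition multiples (d : nat) : set nat := [set n | (0 < n)%N /\ (d %| n)%N].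

Lemma multiples1 : multiples 1 = posn.
Proof. by apply/seteqP; split=> n /= => [[]|]. Qed.

Lemma multiplesI d e : multiples d `&` multiples e = multiples (lcmn d e).
Proof.
apply/seteqP; split=> n /=; rewrite /multiples/= dvdn_lcm.
  by case=> [[n0 ->] [_ ->]].
by case=> n0 /andP[-> ->].
Qed.

Definition finitely_additive (R : realType) (m : set nat -> R) :=
  forall A B, A `&` B = set0 -> m (A `|` B) = m A + m B.

(** [mean_le_truncations] is the only trace of countable additivity: it bounds a
set that is covered by infinitely many sets of multiples, of which only finitely
many meet a given initial segment. *)
Record divisibility_mean (R : realType) (mu : nat -> set nat -> R) : Prop :=
  DivisibilityMean {
    mean_ge0 : forall N A, 0 <= mu N A;
    mean_additive : forall N, finitely_additive (mu N);
    mean_le_truncations : forall N A M,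
      (forall X, mu N (A `&` `I_X) <= M) -> mu N A <= M;
    mean_multiples_le : forall N d, (0 < d)%N ->
      mu N (multiples d) <= d%:R^-1;
    mean_multiples_cvg : forall d, (0 < d)%N ->
      mu N (multiples d) @[N --> \oo] --> (d%:R^-1 : R) }.

Section finitely_additive.
Variables (R : realType) (m : set nat -> R).
Hypothesis m_add : finitely_additive m.

Lemma additiveID A B : m A = m (A `&` B) + m (A `\` B).
Proof. by rewrite -m_add ?setUIDK// setDE setIACA setICr setI0. Qed.

Lemma additive_set0 : m set0 = 0.
Proof. by have := additiveID set0 set0; rewrite setI0 set0D; lra. Qed.

Lemma additive_restrict C : finitely_additive (fun A => m (A `&` C)).
Proof. by move=> A B AB0; rewrite setIUl m_add// setIACA AB0 set0I. Qed.

Hypothesis m_ge0 : forall A, 0 <= m A.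

Lemma additive_le A B : A `<=` B -> m A <= m B.
Proof.
by move=> AB; rewrite (additiveID B A) (setIidr AB); have := m_ge0 (B `\` A); lra.
Qed.

Lemma additive_leU A B : m (A `|` B) <= m A + m B.
Proof.
rewrite (additiveID _ A) (setIidr (@subsetUl _ A B)).
by apply: lerD => //; apply: additive_le => n [[|]].
Qed.

Definition agree_off (E A B : set nat) := forall n, ~ E n -> (A n <-> B n).

(** The parts of [A] and [B] outside [E] coincide, and those inside both have
weight between 0 and the weight of [E]. *)
Lemma additive_agree_off E A B : agree_off E A B -> `|m A - m B| <= m E.
Proof.
move=> AB; rewrite (additiveID A E) (additiveID B E).
have -> : A `\` E = B `\` E.
  by apply/seteqP; split=> n [/= An En]; split=> //; apply/(AB _ En).
have := m_ge0 (A `&` E); have := m_ge0 (B `&` E).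
have := additive_le (@subIsetr _ A E); have := additive_le (@subIsetr _ B E).
rewrite ler_norml; lra.
Qed.

End finitely_additive.

Section elementary_sets.
Variable R : realType.
Implicit Types A B : set nat.

(** Quantifying over all finitely additive functions replaces an identity between
indicator functions: it says that the indicator of [B] is a linear combination of
indicators of sets of multiples, without integrating functions. *)
Definition elementary B := B `<=` posn /\
  exists s : seq (R * nat), all (fun t => 0 < t.2)%N s /\
    forall m : set nat -> R, finitely_additive m ->
      m B = \sum_(t <- s) t.1 * m (multiples t.2).

Lemma elementary_multiples d : (0 < d)%N -> elementary (multiples d).
Proof.
move=> d0; split=> [n []//|]; exists [:: (1, d)].
by rewrite /= d0; split=> // m _; rewrite big_seq1 mul1r.
Qed.

Lemma elementary_set0 : elementary set0.
Proof.
split=> //; exists [::]; split=> // m /additive_set0 ->.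
by rewrite big_nil.
Qed.

Lemma elementaryC A : elementary A -> elementary (posn `\` A).
Proof.
move=> [A0 [s [s0 sE]]]; split=> [n []//|].
exists ((1, 1%N) :: [seq (- t.1, t.2) | t <- s]); split.
  by rewrite /= all_map.
move=> m m_add; rewrite big_cons big_map/= multiples1 mul1r.
under eq_bigr do rewrite mulNr; rewrite sumrN -sE//.
by rewrite (additiveID m_add posn A) (setIidr A0); lra.
Qed.

(** Restricting a finitely additive function to a fixed set leaves it finitely
additive, so the expansion of [A] can be applied to [m (_ `&` B)], and then that
of [B] to each [m (_ `&` multiples d)]: the two linear combinations multiply. *)
Lemma elementaryI A B : elementary A -> elementary B -> elementary (A `&` B).
Proof.
move=> [A0 [s [s0 sE]]] [B0 [t [t0 tE]]]; split=> [n [/A0]//|].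
exists [seq (x.1 * y.1, lcmn x.2 y.2) | x <- s, y <- t]; split.
  apply/allP => _ /allpairsP[[x y] /= [xs yt ->]] /=.
  by rewrite lcmn_gt0 (allP s0)// (allP t0).
move=> m m_add; rewrite (sE _ (additive_restrict m_add B)) big_allpairs_dep/=.
apply: eq_bigr => x _; rewrite setIC (tE _ (additive_restrict m_add _)).
by rewrite mulr_sumr; apply: eq_bigr => y _; rewrite mulrA setIC multiplesI.
Qed.

Lemma elementaryU A B : elementary A -> elementary B -> elementary (A `|` B).
Proof.
move=> elA elB; have [[A0 _] [B0 _]] := (elA, elB).
have := elementaryC (elementaryI (elementaryC elA) (elementaryC elB)).
by rewrite -setDUr setDD (setIidr _)// => n [/A0|/B0].
Qed.

Lemma elementary_cvg B : elementary B ->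
  exists c : R, forall mu, divisibility_mean mu -> mu N B @[N --> \oo] --> c.
Proof.
move=> [_ [s [s0 sE]]]; exists (\sum_(t <- s) t.1 * t.2%:R^-1) => mu mean_mu.
rewrite (_ : (fun N => mu N B) =
    fun N => \sum_(t <- s | t \in s) t.1 * mu N (multiples t.2)).
  rewrite big_seq; apply: cvg_big => [|t /(allP s0) t0].
    exact: add_continuous.
  by apply: cvgMr; exact: mean_multiples_cvg.
by apply/funext => N; rewrite (sE _ (mean_additive mean_mu N)) big_seq.
Qed.

End elementary_sets.

(** * Approximation by elementary sets *)

Section approximable_sets.
Variable R : realType.
Implicit Types A B E : set nat.

Definition negligible_up_to (e : R) E :=
  forall mu, divisibility_mean mu -> forall N, mu N E <= e.

Definition approximable A := forall e : R, 0 < e -> exists B E,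
  [/\ elementary R B, negligible_up_to e E & agree_off E A B].

Lemma approximableC A : approximable A -> approximable (posn `\` A).
Proof.
move=> apA e /apA[B [E [elB negE AB]]]; exists (posn `\` B), E; split=> //.
  exact: elementaryC.
by move=> n /AB ABn; split=> -[n0 nA]; split=> // /ABn.
Qed.

Lemma approximableU A B :
  approximable A -> approximable B -> approximable (A `|` B).
Proof.
move=> apA apB e e0; have e20 : 0 < e / 2 by rewrite divr_gt0.
have [A' [E [elA' negE AA']]] := apA _ e20.
have [B' [F [elB' negF BB']]] := apB _ e20.
exists (A' `|` B'), (E `|` F); split.
- exact: elementaryU.
- move=> mu mean_mu N; have := negE _ mean_mu N; have := negF _ mean_mu N.
  have := additive_leU (mean_additive mean_mu N) (mean_ge0 mean_mu N) E F.
  lra.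
- move=> n /not_orP[/AA'[AA1 AA2] /BB'[BB1 BB2]]; split.
    by case=> [/AA1|/BB1]; [left|right].
  by case=> [/AA2|/BB2]; [left|right].
Qed.

Lemma elementary_approximable A : elementary R A -> approximable A.
Proof.
move=> elA e e0; exists A, set0; split=> // mu mean_mu N.
by rewrite (additive_set0 (mean_additive mean_mu N)) ltW.
Qed.

(** The set is a finite disjoint union of sets of multiples of p^l that are not
multiples of p^(l+1), over the values l < L in [B]. *)
Lemma elementary_logn_lt p (B : set nat) L : prime p ->
  elementary R [set n | [/\ posn n, (logn p n < L)%N & B (logn p n)]].
Proof.
move=> pp; elim: L => [|L IH].
  rewrite (_ : mkset _ = set0); first exact: elementary_set0.
  by apply/seteqP; split=> n // [].
have pL k : elementary R (multiples (p ^ k)).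
  by apply: elementary_multiples; rewrite expn_gt0 prime_gt0.
have [BL|nBL] := pselect (B L); last first.
  rewrite (_ : mkset _ = [set n | [/\ posn n, (logn p n < L)%N & B (logn p n)]])//.
  apply/seteqP; split=> n /= [n0 nL Bn]; split=> //; last exact: ltnW.
  rewrite ltn_neqAle -ltnS nL andbT; apply/eqP => lnE.
  by apply: nBL; rewrite -lnE.
have := elementaryU IH (elementaryI (pL L) (elementaryC (pL L.+1))).
congr elementary; apply/seteqP; split=> n /=.
  case=> [[n0 nL Bn]|[[n0 nL] [_ nL1]]]; first by split=> //; exact: ltnW.
  have lnE : logn p n = L.
    move: nL nL1; rewrite /multiples/= !pfactor_dvdn// => nL nL1.
    apply/eqP; rewrite eqn_leq nL andbT leqNgt; apply/negP => nL'.
    exact: nL1.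
  by split=> //; rewrite lnE.
case=> n0; rewrite ltnS leq_eqVlt => /predU1P[lnE|nL] Bn; last by left.
right; split; first by split=> //; rewrite pfactor_dvdn// lnE.
by split=> // -[_]; rewrite pfactor_dvdn// lnE ltnn.
Qed.

(** Integers whose p-adic order is at least L are multiples of p^L, and p^(-L)
is small: this is why infinite sets [B] are no obstacle. *)
Lemma approximable_logn p (B : set nat) : prime p ->
  approximable [set n | posn n /\ B (logn p n)].
Proof.
move=> pp e e0; set L := Num.bound e^-1.
exists [set n | [/\ posn n, (logn p n < L)%N & B (logn p n)]],
  (multiples (p ^ L)); split; first exact: elementary_logn_lt.
- move=> mu mean_mu N.
  have pL0 : (0 < p ^ L)%N by rewrite expn_gt0 prime_gt0.
  apply: le_trans (mean_multiples_le mean_mu N pL0) _.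
  rewrite -[leRHS]invrK lef_pV2 ?posrE ?ltr0n ?invr_gt0//.
  apply: le_trans (ltW (archi_boundP _)) _; first by rewrite invr_ge0 ltW.
  by rewrite ler_nat ltnW// ltn_expl// prime_gt1.
- move=> n /= nE; split=> [[n0 Bn]|[]//]; split=> //.
  rewrite ltnNge; apply/negP => nL; apply: nE; split=> //.
  by rewrite pfactor_dvdn.
Qed.

Definition square_multiples M X : set nat :=
  [set n | posn n /\ exists2 d, (M < d <= X)%N & (d ^ 2 %| n)%N].

(** The telescoping bound 1/(d+1)^2 <= 1/d - 1/(d+1), summed over d. *)
Lemma mean_square_multiples mu N M j : divisibility_mean mu -> (0 < M)%N ->
  mu N (square_multiples M (M + j)) <= M%:R^-1 - (M + j)%:R^-1 :> R.
Proof.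
move=> mean_mu M0.
have add_mu := mean_additive mean_mu N; have mu_ge0 := mean_ge0 mean_mu N.
elim: j => [|j IH].
  rewrite (_ : square_multiples _ _ = set0); first by
    rewrite additive_set0// addn0 subrr.
  by apply/seteqP; split=> n // [_ [d]]; rewrite addn0; lia.
set X := (M + j)%N in IH *; rewrite addnS -/X.
have X0 : (0 : R) < X%:R by rewrite ltr0n /X; lia.
have : square_multiples M X.+1 `<=`
    square_multiples M X `|` multiples (X.+1 ^ 2).
  move=> n [n0 [d /andP[Md]]]; rewrite leq_eqVlt => /predU1P[-> dn|dX dn].
    by right.
  by left; split=> //; exists d; rewrite // Md.
move=> /(additive_le add_mu mu_ge0)/le_trans; apply.
apply: le_trans (additive_leU add_mu mu_ge0 _ _) _.
suff dX : ((X.+1 ^ 2)%N%:R : R)^-1 <= X%:R^-1 - X.+1%:R^-1.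
  have := mean_multiples_le mean_mu N (expn_gt0 X.+1 2).
  by move=> /le_trans /(_ dX) /(lerD IH) /le_trans; apply; rewrite addrA subrK.
rewrite natrX -natr1.
rewrite (_ : X%:R^-1 - _ = (X%:R * (X%:R + 1))^-1); last first.
  by field; rewrite !gt_eqF//; lra.
by rewrite lef_pV2 ?posrE; nra.
Qed.

Lemma elementary_no_prime_power k M :
  elementary R [set n | posn n /\
    forall p, prime p -> (p <= M)%N -> ~~ (p ^ k %| n)%N].
Proof.
elim: M => [|M IH].
  have := @elementary_multiples R 1 isT; rewrite multiples1.
  congr elementary; apply/seteqP; split=> n //= [] //.
  by move=> n0; split=> // p /prime_gt0; lia.
have [pM|npM] := boolP (prime M.+1); last first.
  move: IH; congr elementary; apply/seteqP; split=> n /= [n0 np]; split=> // p.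
    move=> pp; rewrite leq_eqVlt => /predU1P[pE|]; last exact: np.
    by rewrite pE (negPf npM) in pp.
  by move=> pp pM; apply: np => //; exact: ltnW.
have elM : elementary R (multiples (M.+1 ^ k)).
  by apply: elementary_multiples; rewrite expn_gt0.
have := elementaryI IH (elementaryC elM).
congr elementary; apply/seteqP; split=> n /=.
  move=> [[n0 np] [_ nM]]; split=> // p pp; rewrite leq_eqVlt.
  by case/predU1P => [->|]; [apply/negP => ?; exact: nM|exact: np].
move=> [n0 np]; split; first by split=> // p pp pM'; apply: np => //; exact: ltnW.
by split=> // -[_]; apply/negP; exact: np.
Qed.

(** An integer with no p^k-divisor for p <= M fails to be k-free only through a
prime p > M, and then p^2 divides it because 2 <= k. *)
Lemma approximable_kfree k : (2 <= k)%N -> approximable (kfree k).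
Proof.
move=> k2 e e0; set M := Num.bound e^-1.
have ltM : e^-1 < M%:R by apply: archi_boundP; rewrite invr_ge0 ltW.
have Mpos : 0 < M%:R :> R by apply: lt_trans ltM; rewrite invr_gt0.
have M0 : (0 < M)%N by rewrite ltr0n in Mpos.
have eM : M%:R^-1 <= e by rewrite -[leRHS]invrK lef_pV2 ?posrE ?invr_gt0// ltW.
exists [set n | posn n /\
    forall p, prime p -> (p <= M)%N -> ~~ (p ^ k %| n)%N],
  [set n | posn n /\ exists2 d, (M < d)%N & (d ^ 2 %| n)%N]; split.
- exact: elementary_no_prime_power.
- move=> mu mean_mu N; apply: le_trans eM.
  (* d^2 <= n < X forces d <= M + X, so finitely many d matter below X *)
  apply: (mean_le_truncations mean_mu) => X.
  apply: (@le_trans _ _ (mu N (square_multiples M (M + X)))).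
    apply: additive_le; [exact: mean_additive|exact: mean_ge0|].
    move=> n [[n0 [d Md dn]] /= nX]; split=> //; exists d => //.
    have := dvdn_leq n0 dn; rewrite Md -mulnn; nia.
  apply: le_trans (mean_square_multiples _ _ mean_mu M0) _.
  by rewrite lerBlDr lerDl invr_ge0.
- move=> n nE; split=> [[n0 np]|[n0 np]]; split=> // p pp.
    by move=> _; exact: np.
  have [pM|Mp] := leqP p M; first exact: np.
  apply/negP => pn; apply: nE; split=> //; exists p => //.
  exact: dvdn_trans (dvdn_exp2l p k2) pn.
Qed.

End approximable_sets.

(** * Means given by weights *)

Section weighted_means.
Variables (R : realType) (w : nat -> R) (D : nat -> set nat) (c : nat -> R).
Hypotheses (w_ge0 : forall n, 0 <= w n) (c_ge0 : forall N, 0 <= c N).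
Hypothesis wD : forall N, (\esum_(n in D N) (w n)%:E < +oo)%E.

Lemma weighted_divisibility_mean :
  (forall N d, (0 < d)%N ->
    c N * weight_mass w (D N) (multiples d) <= d%:R^-1) ->
  (forall d, (0 < d)%N ->
    c N * weight_mass w (D N) (multiples d) @[N --> \oo] --> (d%:R^-1 : R)) ->
  divisibility_mean (fun N A => c N * weight_mass w (D N) A).
Proof.
move=> le_d cvg_d; split=> // [N A|N A B AB0|N A M bnd].
- by rewrite mulr_ge0// weight_mass_ge0.
- by rewrite weight_massU// mulrDr.
have := c_ge0 N; rewrite le_eqVlt => /predU1P[c0|c0].
  by have := bnd 0%N; rewrite -c0 !mul0r.
rewrite mulrC -ler_pdivlMr//; apply: weight_mass_le_truncations => // X.
by rewrite ler_pdivlMr// mulrC.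
Qed.

End weighted_means.

(** * Natural density *)

Section natural_density.
Variable R : realType.

Let interval (N : nat) : set nat := [set n | (1 <= n <= N)%N].

Lemma finite_interval N : finite_set (interval N).
Proof.
apply: sub_finite_set (finite_II N.+1) => n /=; rewrite /interval/=; lia.
Qed.

Lemma nat_freqE A N :
  nat_freq R A N = N%:R^-1 * weight_mass (fun=> 1 : R) (interval N) A.
Proof.
rewrite /nat_freq /weight_mass finite_card_sum ?fineK// 1?mulrC//.
by apply: finite_setI; right; exact: finite_interval.
Qed.

Lemma card_multiples d N : (0 < d)%N ->
  #|` fset_set (multiples d `&` interval N)| = (N %/ d)%N.
Proof.
move=> d0; apply: card_fset_set.
rewrite (_ : _ `&` _ = (fun k => d * k.+1)%N @` `I_(N %/ d)); last first.
  apply/seteqP; split=> n /=.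
    case=> -[n0 /dvdnP[k nE]] /andP[_ nN]; case: k nE => [|k] nE.
      by rewrite nE in n0.
    by exists k; [rewrite leq_divRL// -nE|rewrite nE mulnC].
  move=> [k]; rewrite leq_divRL// => kN <-.
  rewrite /multiples /interval /= muln_gt0 d0 mulnC kN.
  by rewrite dvdn_mull.
by apply: inj_card_eq => k l _ _ /eqP; rewrite eqn_pmul2l// => /eqP[].
Qed.

Lemma nat_freq_multiples d N : (0 < d)%N ->
  nat_freq R (multiples d) N = (N %/ d)%:R / N%:R.
Proof. by move=> d0; rewrite /nat_freq card_multiples. Qed.

(** The frequency of the multiples of d is floor(N/d)/N, which lies between
1/d - 1/N and 1/d. *)
Lemma nat_freq_divisibility_mean :
  divisibility_mean (fun N A => nat_freq R A N).
Proof.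
rewrite (_ : (fun N A => _) = fun N A =>
    N%:R^-1 * weight_mass (fun=> 1 : R) (interval N) A); last first.
  by apply/funext => N; apply/funext => A; exact: nat_freqE.
have d_le (N d : nat) : (0 < d)%N -> (N %/ d)%:R * d%:R <= N%:R :> R.
  by move=> d0; rewrite -natrM ler_nat leq_trunc_div.
have d_ge (N d : nat) : (0 < d)%N -> N%:R <= (N %/ d)%:R * d%:R + d%:R :> R.
  by move=> d0; rewrite -natrM -natrD ler_nat {1}(divn_eq N d) leq_add2l ltnW// ltn_pmod.
apply: weighted_divisibility_mean => // [N|N d d0|d d0].
- rewrite finite_card_sum ?ltry//; exact: finite_interval.
- rewrite -nat_freqE nat_freq_multiples//.
  have [->|N0] := posnP N; first by rewrite invr0 mulr0 invr_ge0.
  rewrite ler_pdivrMr ?ltr0n// mulrC ler_pdivlMr ?ltr0n//; exact: d_le.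
under eq_fun do rewrite -nat_freqE nat_freq_multiples//.
apply/cvgrPdist_le => e e0.
near=> N.
have N0 : 0 < N%:R :> R by rewrite ltr0n; near: N; exact: nbhs_infty_gt.
have Ne : e^-1 <= N%:R by near: N; exact: nbhs_infty_ger.
have dpos : 0 < d%:R :> R by rewrite ltr0n.
have -> : d%:R^-1 - (N %/ d)%:R / N%:R =
    (N%:R - (N %/ d)%:R * d%:R) / d%:R / N%:R :> R.
  by field; rewrite !gt_eqF.
rewrite ger0_norm; last by rewrite !divr_ge0// ?subr_ge0 ?d_le// ltW.
rewrite ler_pdivrMr// ler_pdivrMr//.
have : 1 <= e * N%:R by rewrite mulrC -ler_pdivrMr// mul1r.
have := d_ge N d d0; nra.
Unshelve. all: by end_near. Qed.

End natural_density.

(** * Logarithmic independence density *)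

Lemma nth_prime_prime j : (0 < j)%N -> prime (nth_prime j).
Proof.
by case: j => // j _; rewrite /nth_prime iterS /next_prime; case: ex_minnP => p /andP[].
Qed.

Lemma nth_prime_ge j : (j <= nth_prime j)%N.
Proof.
elim: j => // j IH; rewrite /nth_prime iterS /next_prime.
by case: ex_minnP => p /andP[jp _] _; exact: leq_ltn_trans jp.
Qed.

(** By induction on j, a prime either appears among the first j or exceeds the
j-th; the latter fails at j = p, since the j-th prime is at least j. *)
Lemma nth_prime_surj p : prime p -> exists2 j, (0 < j)%N & nth_prime j = p.
Proof.
move=> pp.
have : forall j, (exists2 i, (0 < i)%N & nth_prime i = p) \/ (nth_prime j < p)%N.
  elim=> [|j [|jp]]; [by right; rewrite prime_gt0|by left|].
  have : (nth_prime j.+1 <= p)%N.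
    rewrite /nth_prime iterS -/(nth_prime j) /next_prime.
    by case: ex_minnP => q _; apply; rewrite jp.
  rewrite leq_eqVlt => /predU1P[|]; [by left; exists j.+1|by right].
by case/(_ p) => //; rewrite ltnNge nth_prime_ge.
Qed.

Lemma Omega_mul N m n : Omega N m -> Omega N n -> Omega N (m * n).
Proof.
move=> [m0 mN] [n0 nN]; split=> [|j Nj]; first by rewrite /posn/= muln_gt0 m0.
have j0 : (0 < j)%N by exact: leq_ltn_trans Nj.
by rewrite Euclid_dvdM ?nth_prime_prime// negb_or mN// nN.
Qed.

Lemma Omega_divisor N m n : Omega N (m * n) -> Omega N n.
Proof.
move=> [+ mnN]; rewrite /posn/= muln_gt0 => /andP[_ n0]; split=> // j Nj.
by apply: contra (mnN j Nj) => /dvdn_mull.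
Qed.

Lemma Omega_eventually d N : (0 < d)%N -> (d <= N)%N -> Omega N d.
Proof.
move=> d0 dN; split=> // j Nj; apply/negP => /(dvdn_leq d0).
by have := nth_prime_ge j; lia.
Qed.

Lemma Omega0 : Omega 0 `<=` [set 1%N].
Proof.
move=> n [n0 nN] /=; apply/eqP; apply: contraT => n1.
have [j j0 jE] : exists2 j, (0 < j)%N & nth_prime j = pdiv n.
  by apply: nth_prime_surj; apply: pdiv_prime; rewrite /posn/= in n0; lia.
by have := nN _ j0; rewrite jE pdiv_dvd.
Qed.

Lemma OmegaS N : Omega N.+1 `\` multiples (nth_prime N.+1) `<=` Omega N.
Proof.
move=> n [[n0 nN] np]; split=> // j; rewrite leq_eqVlt => /predU1P[<-|].
  by apply/negP => pn; apply: np.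
exact: nN.
Qed.

Section log_independence_density.
Variable R : realType.

Let harmonic (n : nat) : R := n%:R^-1.

Let harmonic_ge0 n : 0 <= harmonic n. Proof. by rewrite /harmonic invr_ge0. Qed.
Let harmonic_ge0E n : (0 <= (harmonic n)%:E)%E. Proof. by rewrite lee_fin. Qed.

Lemma esum_harmonic_dilate d A : (0 < d)%N ->
  (\esum_(n in muln d @` A) (harmonic n)%:E =
   (d%:R^-1)%:E * \esum_(n in A) (harmonic n)%:E)%E.
Proof.
move=> d0; rewrite esum_image; last first.
  by move=> m n _ _ /eqP; rewrite eqn_pmul2l// => /eqP.
rewrite -esumZl ?invr_ge0//; apply: eq_esum => n _.
by rewrite -EFinM /harmonic natrM invfM.
Qed.

Lemma esum_harmonic_multiples_le d (S : set nat) : (0 < d)%N ->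
  (forall n, S (d * n)%N -> S n) ->
  (\esum_(n in multiples d `&` S) (harmonic n)%:E <=
   (d%:R^-1)%:E * \esum_(n in S) (harmonic n)%:E)%E.
Proof.
move=> d0 Sd; rewrite -esum_harmonic_dilate//; apply: subset_esum.
move=> n [[n0 /dvdnP[k]]]; rewrite mulnC => -> Sk.
by exists k => //; exact: Sd.
Qed.

Lemma esum_harmonic_truncation X : (\esum_(n in `I_X) (harmonic n)%:E < +oo)%E.
Proof.
apply: (@le_lt_trans _ _ (\esum_(n in `I_X) (1%:E : \bar R))%E).
  apply: le_esum => n _; rewrite lee_fin /harmonic.
  by case: n => [|n]; rewrite ?invr0// invf_le1 ?ltr0n// ler1n.
rewrite finite_card_sum ?ltry//; exact: finite_II.
Qed.

(** Let p be the (N+1)-th prime.  The multiples of p in Omega_{N+1} are p times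
elements of Omega_{N+1}, and the remaining elements lie in Omega_N, so the
truncated sums satisfy S_{N+1} <= S_{N+1}/p + S_N, whence S_{N+1} <= 2 S_N as
p >= 2.  Working below a bound X makes the sums finite a priori, as the
absorption of S_{N+1}/p requires. *)
Lemma harmonic_mass_Omega_le N : (harmonic_mass R (Omega N) <= (2 ^+ N)%:E)%E.
Proof.
apply: esum_le_truncations => X.
have IX := esum_harmonic_truncation X.
rewrite -[X in (X <= _)%E](weight_massK harmonic_ge0 IX) lee_fin.
elim: N => [|N IH].
  rewrite -lee_fin (weight_massK harmonic_ge0 IX).
  apply: (@le_trans _ _ (\esum_(n in [set 1%N]) (harmonic n)%:E)%E).
    by apply: subset_esum => n [/Omega0].
  by rewrite esum_set1// /harmonic invr1 expr0.
set p := nth_prime N.+1.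
have p_gt1 : (1 < p)%N by rewrite prime_gt1// nth_prime_prime.
have massU := weight_massU harmonic_ge0 IX.
have mass0 := weight_mass_ge0 harmonic_ge0 IX.
have le1 : weight_mass harmonic `I_X (Omega N.+1 `&` multiples p) <=
    p%:R^-1 * weight_mass harmonic `I_X (Omega N.+1).
  rewrite -lee_fin EFinM !(weight_massK harmonic_ge0 IX).
  rewrite (setIC (Omega _)) -setIA; apply: esum_harmonic_multiples_le; first lia.
  move=> n [/Omega_divisor On /= nX]; split=> //=; nia.
have le2 := additive_le massU mass0 (@OmegaS N).
have := additiveID massU (Omega N.+1) (multiples p).
have p2 : p%:R^-1 <= 2^-1 :> R by rewrite lef_pV2 ?posrE ?ltr0n ?ler_nat//; lia.
have := ler_wpM2r (mass0 (Omega N.+1)) p2.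
rewrite exprS; move: le1 le2 IH; rewrite -/p; lra.
Qed.

Lemma harmonic_mass_Omega_lty N : (harmonic_mass R (Omega N) < +oo)%E.
Proof. exact: le_lt_trans (harmonic_mass_Omega_le N) (ltry _). Qed.

Lemma C_E N : (C_ R N)%:E = harmonic_mass R (Omega N).
Proof.
by rewrite /C_ fineK// ge0_fin_numE ?harmonic_mass_Omega_lty// esum_ge0.
Qed.

Lemma C_gt0 N : 0 < C_ R N.
Proof.
apply: (@lt_le_trans _ _ 1) => //; rewrite -lee_fin C_E.
apply: (@le_trans _ _ (\esum_(n in [set 1%N]) (harmonic n)%:E)%E).
  by rewrite esum_set1// /harmonic invr1.
apply: subset_esum => _ ->; split=> // j Nj; rewrite dvdn1 gtn_eqF//.
by rewrite prime_gt1// nth_prime_prime// (leq_ltn_trans _ Nj).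
Qed.

(** Division by d maps the multiples of d in Omega_N injectively into Omega_N,
and onto it once N >= d, when d itself belongs to Omega_N.  So P_N gives the
multiples of d weight at most 1/d, and exactly 1/d for large N. *)
Lemma P_divisibility_mean : divisibility_mean (P_ R).
Proof.
have massK N A := weight_massK harmonic_ge0 (harmonic_mass_Omega_lty N) A.
apply: weighted_divisibility_mean => // [N||N d d0|d d0].
- by rewrite invr_ge0 ltW// C_gt0.
- exact: harmonic_mass_Omega_lty.
- rewrite ler_pdivrMl ?C_gt0// mulrC -lee_fin EFinM massK C_E.
  by apply: esum_harmonic_multiples_le => // n; exact: Omega_divisor.
apply: cvg_near_cst; near=> N.
have dN : (d <= N)%N by near: N; exact: nbhs_infty_ge.
rewrite (_ : weight_mass _ _ _ = d%:R^-1 * C_ R N).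
  by rewrite mulrCA mulVf ?mulr1// gt_eqF// C_gt0.
apply: EFin_inj; rewrite EFinM massK C_E -esum_harmonic_dilate//.
congr (esum _ _); apply/seteqP; split=> n /=.
  move=> [[n0 /dvdnP[k]]]; rewrite mulnC => -> Ok.
  by exists k => //; exact: Omega_divisor Ok.
move=> [k Ok <-]; split; last exact: Omega_mul (Omega_eventually d0 dN) Ok.
by split; [rewrite muln_gt0 d0; case: Ok|exact: dvdn_mulr].
Unshelve. all: by end_near. Qed.

End log_independence_density.

(** * Coincidence *)

(** At each precision e a single number c, the limit for an approximating
elementary set, is eventually e-close to the weights of [A] under every mean.
Hence each sequence of weights is Cauchy, and any two limits are 2e-close. *)
Lemma approximable_cvg (R : realType) (A : set nat) (mu nu : nat -> set nat -> R) :
  approximable R A -> divisibility_mean mu -> divisibility_mean nu ->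
  [/\ cvgn (mu ^~ A), cvgn (nu ^~ A) &
      limn (mu ^~ A) = limn (nu ^~ A)].
Proof.
move=> apA mean_mu mean_nu.
have near_c (e : R) : 0 < e -> exists c : R,
    forall mu, divisibility_mean mu -> \forall N \near \oo, `|c - mu N A| <= e.
  move=> e0; have e20 : 0 < e / 2 by rewrite divr_gt0.
  have [B [E [elB negE AB]]] := apA _ e20.
  have [c cvg_c] := elementary_cvg elB; exists c => rho mean_rho.
  have /cvgrPdist_le/(_ _ e20) := cvg_c _ mean_rho; apply: filterS => N cB.
  have := additive_agree_off (mean_additive mean_rho N) (mean_ge0 mean_rho N) AB.
  have := negE _ mean_rho N.
  move: cB; rewrite !ler_norml; lra.
have cvgA (rho : nat -> set nat -> R) : divisibility_mean rho -> cvgn (rho ^~ A).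
  move=> mean_rho; apply/cauchy_cvgP/cauchy_exP => e e0.
  have e20 : 0 < e / 2 by rewrite divr_gt0.
  have [c /(_ _ mean_rho) near_cA] := near_c _ e20; exists c.
  by move: near_cA; apply: filterS => N; rewrite /ball/=; lra.
have [cmu cnu] := (cvgA _ mean_mu, cvgA _ mean_nu); split=> //.
apply/eqP; rewrite -subr_eq0 -normr_le0; apply/ler_addgt0Pl => e e0.
rewrite addr0; have e20 : 0 < e / 2 by rewrite divr_gt0.
have [c near_cA] := near_c _ e20.
have lim_c (rho : nat -> set nat -> R) :
    divisibility_mean rho -> `|c - limn (rho ^~ A)| <= e / 2.
  move=> mean_rho.
  have norm_cvg : `|c - rho N A| @[N --> \oo] --> `|c - limn (rho ^~ A)|.
    by apply: cvg_norm; apply: cvgB; [exact: cvg_cst|exact: cvgA].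
  rewrite -(cvg_lim _ norm_cvg)//; apply: limr_le; last exact: near_cA.
  by apply/cvg_ex; eexists; exact: norm_cvg.
have := lim_c _ mean_mu; have := lim_c _ mean_nu.
rewrite !ler_norml; lra.
Qed.

Lemma generated_algebra_approximable (R : realType) (A : set nat) :
  generated_algebra A -> approximable R A.
Proof.
move=> /(_ (approximable R)); apply; split.
  split.
  - exact: elementary_approximable (elementary_set0 R).
  - by move=> B; exact: approximableC.
  - by move=> B C; exact: approximableU.
move=> _ [[j [B [j0 ->]]]|[k [k2 ->]]].
  by apply: approximable_logn; exact: nth_prime_prime.
exact: approximable_kfree.
Qed.

Theorem proposition3 (R : realType) :
  densities_coincide_on R generated_algebra.
Proof.
move=> A /(@generated_algebra_approximable R) apA.
exact: approximable_cvg apA (P_divisibility_mean R) (nat_freq_divisibility_mean R).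
Qed.
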